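(* Let $X,Y$ be compact metric spaces and $f:X\dashrightarrow Y$ a continuous open-dense defined map. 1) $f_*(SM^+(X))\subset SM^+(Y)$, and for $\mu\in SM^+(X)$ we have $f_*(\mu)(\pm1)=\mu(\pm1)$; in particular $\|f_*(\mu)\|=\|\mu\|$. 2) Let $Z$ be a compact metric space and $g:Y\dashrightarrow Z$ a continuous open-dense defined map, and suppose there is an open dense $U\subset\mathrm{OpenDom}(f)$ with $f(U)\subset\mathrm{OpenDom}(g)$; let $g\circ f$ denote the continuous open-dense defined map $U\to Z$, $x\mapsto g(f(x))$. Then $g_*f_*(\mu)\ge(g\circ f)_*(\mu)$ for all $\mu\in SM^+(X)$. If $f$ and $g$ are continuous maps defined on all of $X$ and $Y$, equality holds. 3) If $\mu_n\in SM^+(X)$ weakly converges to $\mu$ and $\nu$ is a weak cluster point of $f_*(\mu_n)$, then $\nu\le f_*(\mu)$. If $f$ is a continuous map defined on all of $X$, then $f_*(\mu_n)$ weakly converges to $f_*(\mu)$. 4) If $\mu$ is a finite positive Borel measure on $X$ with $\mu(I(f))=0$, then $f_*(\mu)$ is the usual pushforward measure, i.e. $f_*(\mu)(\varphi)=\int_{X\setminus I(f)}\varphi\circ f\,d\mu$. 5) For every $\mu\in SM^+(X)$, $f_*(\mu)=\sup_{\chi\in\mathcal{G}(\mu)}f_*(\chi)$, where $\mathcal{G}(\mu)$ is the set of finite positive Borel measures $\chi$ on $X$ with $\chi\le\mu$. 6) For all $\mu_1,\mu_2\in SM^+(X)$, $f_*(\mu_1+\mu_2)\ge f_*(\mu_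1)+f_*(\mu_2)$.
   Context: $C^0(X)$: real continuous functions with sup norm. A strong submeasure is a sub-linear and bounded map $\mu:C^0(X)\to\mathbb{R}$ (sub-linear: $\mu(\varphi_1+\varphi_2)\le\mu(\varphi_1)+\mu(\varphi_2)$, $\mu(\lambda\varphi)=\lambda\mu(\varphi)$ for $\lambda\ge0$; bounded: $|\mu(\varphi)|\le C\|\varphi\|_{L^\infty}$, with $\|\mu\|$ the least such $C$); it is positive if non-decreasing. $SM^+(X)$ denotes positive strong submeasures; finite positive Borel measures are elements of $SM^+(X)$ via integration. $\mu\le\nu$ means $\mu(\varphi)\le\nu(\varphi)$ for all $\varphi$, and suprema of families are taken pointwise. Weak convergence: $\sup_n\|\mu_n\|<\infty$ and $\mu_n(\varphi)\to\mu(\varphi)$ for all $\varphi$. A continuous open-dense defined map $f:X\dashrightarrow Y$ is a continuous map $f:\mathrm{OpenDom}(f)\to Y$ with $\mathrm{OpenDom}(f)\subset X$ open dense; $I(f)=X\setminus\mathrm{OpenDom}(f)$. For $U\subset X$ open dense and bounded $g:U\to\mathbb{R}$, $E(g)=g$ on $U$ and $E(g)(x)=\limsup_{y\in U,y\to x}g(y)$ for $x\notin U$. For $\varphi\in C^0(Y)$, $f^*(\varphi):=E(\varphi\circ f)$ (bounded upper-semicontinuous on $X$, with $U$ the domain of $f$). The pushforward of $\mu\in SM^+(X)$ is $f_*(\mu)(\varphi):=\inf\{\mu(\psi):\psi\in C^0(X),\ \psi\ge f^*(\varphi)\}$ for $\varphi\in C^0(Y)$. *)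

(* Defs.v *)
From HB Require Import structures.
From mathcomp Require Import all_boot all_order all_algebra.
From mathcomp Require Import all_classical all_reals all_analysis.
Set Implicit Arguments. Unset Strict Implicit. Unset Printing Implicit Defensive.
Import Order.TTheory GRing.Theory Num.Theory.
Import numFieldNormedType.Exports.
Local Open Scope classical_set_scope.
Local Open Scope ring_scope.

Section SubMeasures.
Variables (R : realType) (X : topologicalType).

(* sup norm of a (continuous, hence bounded on compact X) function *)
Definition supnorm (phi : X -> R) : R := sup (range (fun x => `|phi x|)).

(* submeasures are maps (X -> R) -> R, only their values on continuous
   functions matter *)
Definition strong_submeasure (mu : (X -> R) -> R) : Prop :=
  [/\ (forall p q : X -> R, continuous p -> continuous q ->
          mu (fun x => p x + q x) <= mu p + mu q),
      (forall (l : R) (p : X -> R), continuous p -> 0 <= l ->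
          mu (fun x => l * p x) = l * mu p) &
      (exists C : R, forall p : X -> R, continuous p -> `|mu p| <= C * supnorm p)].

Definition SMplus (mu : (X -> R) -> R) : Prop :=
  strong_submeasure mu /\
  (forall p q : X -> R, continuous p -> continuous q ->
     (forall x, p x <= q x) -> mu p <= mu q).

Definition sm_norm (mu : (X -> R) -> R) : R :=
  inf [set C : R | 0 <= C /\
        forall p : X -> R, continuous p -> `|mu p| <= C * supnorm p].

Definition sm_le (mu nu : (X -> R) -> R) : Prop :=
  forall p : X -> R, continuous p -> mu p <= nu p.

Definition weak_cvg (mun : nat -> (X -> R) -> R) (mu : (X -> R) -> R) : Prop :=
  (exists M : R, forall n, sm_norm (mun n) <= M) /\
  (forall p : X -> R, continuous p -> (fun n => mun n p) @ \oo --> mu p).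

Definition weak_cluster (mun : nat -> (X -> R) -> R) (nu : (X -> R) -> R) : Prop :=
  exists sigma : nat -> nat, (forall n, (sigma n < sigma n.+1)%N) /\
    weak_cvg (fun n => mun (sigma n)) nu.

Definition Eext (U : set X) (g : X -> R) (x : X) : R :=
  if pselect (U x) then g x
  else inf [set sup (g @` (V `&` U)) | V in open_nbhs x].

End SubMeasures.

(* continuous open-dense defined map f : X -->  Y with OpenDom(f) = D *)
Definition odmap (X Y : topologicalType) (D : set X) (f : X -> Y) : Prop :=
  [/\ open D, dense D & forall x, D x -> {for x, continuous f}].

Definition smpull (R : realType) (X Y : topologicalType) (D : set X) (f : X -> Y)
  (phi : Y -> R) : X -> R := Eext D (phi \o f).

Definition smpush (R : realType) (X Y : topologicalType) (D : set X) (f : X -> Y)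
  (mu : (X -> R) -> R) (phi : Y -> R) : R :=
  inf [set mu psi | psi in [set psi : X -> R | continuous psi /\
                              forall x, smpull D f phi x <= psi x]].

(* Borel measurable space on X: sigma-algebra generated by the open sets.
   The library's measurable types must be pointed, so a point x0 is supplied. *)
Definition borelT (X : topologicalType) (x0 : X) : Type := X.
HB.instance Definition _ (X : topologicalType) (x0 : X) := Choice.on (@borelT X x0).
HB.instance Definition _ (X : topologicalType) (x0 : X) :=
  isPointed.Build (@borelT X x0) x0.
Definition BorelSpace (X : topologicalType) (x0 : X) :=
  g_sigma_algebraType (T := @borelT X x0) (@open X).
HB.instance Definition _ (X : topologicalType) (x0 : X) :=
  Measurable.copy (@BorelSpace X x0) (g_sigma_algebraType (T := @borelT X x0) (@open X)).

Definition meas_sm (R : realType) (X : topologicalType) (x0 : X)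
  (mu : {finite_measure set @BorelSpace X x0 -> \bar R}) : (X -> R) -> R :=
  fun phi => fine (\int[mu]_x (phi x)%:E)%E.

(* Main.v *)
(** A continuous function dominates the upper semicontinuous extension of
    [phi \o f] as soon as it dominates [phi \o f] on the dense set [D]; hence
    [smpush D f mu phi] is the infimum of [mu psi] over the continuous majorants
    [psi] of [phi \o f] on [D], and (1), (2), (3) and (6) are manipulations of
    such infima. For (4), [phi \o f] is on [D] a pointwise limit of uniformly
    bounded Lipschitz majorants, so dominated convergence applies. For (5), the
    infimum makes sense for every function bounded on [D] and is sublinear there;
    by Hahn-Banach it dominates a linear functional that agrees with it at
    [phi \o f]. The restriction of that functional to continuous functions is
    positive, dominated by [mu], and at least [smpush D f mu phi] at each
    continuous majorant of [phi \o f] on [D]; by the Riesz representation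
    theorem it is integration against a finite measure. *)

Require Import Defs.
From HB Require Import structures.
From mathcomp Require Import all_boot all_order all_algebra.
From mathcomp Require Import all_classical all_reals all_analysis.
From mathcomp Require Import measurable_realfun.
From mathcomp Require Import lra zify.
Import Order.TTheory GRing.Theory Num.Theory.
Import numFieldNormedType.Exports.
Local Open Scope classical_set_scope.
Local Open Scope ring_scope.
Set Implicit Arguments.
Unset Strict Implicit.
Unset Printing Implicit Defensive.

(** * Hahn-Banach *)

Section HahnBanach.
Context {R : realType} {V : lmodType R}.
Variable S : set V.
Hypothesis SD : forall u v, S u -> S v -> S (u + v).
Hypothesis SZ : forall l u, S u -> S (l *: u).

(** Stated relative to a set [S] closed under the operations, so that it applies directly to total
    functions [X -> R] that are bounded on [D]. *)
Definition sublinear_on (q : V -> R) : Prop :=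
  (forall u v, S u -> S v -> q (u + v) <= q u + q v) /\
  (forall l u, 0 <= l -> S u -> q (l *: u) = l * q u).

Lemma sublinear0 (q : V -> R) u : sublinear_on q -> S u -> q 0 = 0.
Proof. by move=> [_ qZ] Su; rewrite -(scale0r u) qZ// mul0r. Qed.

Lemma sublinearN_ge (q : V -> R) u : sublinear_on q -> S u -> - q (- u) <= q u.
Proof.
move=> qs Su; have SNu : S (- u) by rewrite -scaleN1r; exact: SZ.
have := qs.1 _ _ Su SNu; rewrite subrr (sublinear0 qs Su); lra.
Qed.

(* [sublinear_slope q y] is the largest sublinear minorant of [q] whose value
   at [- y] is at most [- q y]. *)
Definition sublinear_slope (q : V -> R) (y u : V) : R :=
  inf [set q (u + t *: y) - t * q y | t in [set t | 0 <= t]].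

(** Subadditivity for [t *: y = (u + t *: y) - u]. The bound is free of [t], so the infimum defining
    the slope is a true infimum and not a default value. *)
Lemma sublinear_slope_bound q y u t : sublinear_on q -> S y -> S u ->
  0 <= t -> - q (- u) <= q (u + t *: y) - t * q y.
Proof.
move=> qs Sy Su t0; have SNu : S (- u) by rewrite -scaleN1r; exact: SZ.
have := qs.1 (u + t *: y) (- u) (SD Su (SZ t Sy)) SNu.
rewrite addrAC subrr add0r qs.2//; lra.
Qed.

Lemma sublinear_slope_le q y u t : sublinear_on q -> S y -> S u -> 0 <= t ->
  sublinear_slope q y u <= q (u + t *: y) - t * q y.
Proof.
move=> qs Sy Su t0; apply: ge_inf; last by exists t.
by exists (- q (- u)) => _ [s s0 <-]; exact: sublinear_slope_bound.
Qed.

Lemma sublinear_slope_ge q y u c : 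
  (forall t, 0 <= t -> c <= q (u + t *: y) - t * q y) ->
  c <= sublinear_slope q y u.
Proof.
move=> H; apply: lb_le_inf; first by exists (q (u + 0 *: y) - 0 * q y), 0 => /=.
by move=> _ [t t0 <-]; exact: H.
Qed.

Lemma sublinear_slope_sublinear q y : sublinear_on q -> S y ->
  sublinear_on (sublinear_slope q y).
Proof.
move=> qs Sy; split=> [u v Su Sv|l u l0 Su].
  (* The infima at [u] and at [v] are unfolded one after the other; the parameters [t] and [s] are
     answered by [t + s]. *)
  rewrite -lerBlDr; apply: sublinear_slope_ge => t t0.
  rewrite lerBlDr -lerBlDl; apply: sublinear_slope_ge => s s0.
  rewrite lerBlDl.
  have := sublinear_slope_le qs Sy (SD Su Sv) (addr_ge0 t0 s0).
  have := qs.1 _ _ (SD Su (SZ t Sy)) (SD Sv (SZ s Sy)).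
  rewrite scalerDl addrACA; lra.
have [->|l_neq0] := eqVneq l 0.
  rewrite mul0r scale0r; apply/eqP; rewrite eq_le; apply/andP; split.
    have S0 : S 0 by rewrite -(scale0r u); exact: SZ.
    have := sublinear_slope_le qs Sy S0 (lexx 0).
    by rewrite scale0r addr0 (sublinear0 qs Su) mul0r subr0.
  by apply: sublinear_slope_ge => t t0; rewrite add0r qs.2// subrr.
have {l_neq0} l_gt0 : 0 < l by rewrite lt_neqAle eq_sym l_neq0.
apply/eqP; rewrite eq_le; apply/andP; split.
  rewrite -ler_pdivrMl//; apply: sublinear_slope_ge => t t0.
  rewrite ler_pdivrMl//.
  have := sublinear_slope_le qs Sy (SZ l Su) (mulr_ge0 l0 t0).
  rewrite -scalerA -scalerDr qs.2//; last exact: (SD Su (SZ t Sy)).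
  by rewrite mulrBr mulrA.
apply: sublinear_slope_ge => t t0; rewrite -ler_pdivlMl//.
(* Dividing by [l] turns the parameter [t] at [l *: u] into [l^-1 * t] at [u]. *)
have lt0 : 0 <= l^-1 * t by rewrite mulr_ge0// invr_ge0.
apply: le_trans (sublinear_slope_le qs Sy Su lt0) _.
rewrite mulrBr -(qs.2 l^-1) ?invr_ge0//; last exact: (SD (SZ l Su) (SZ t Sy)).
by rewrite scalerDr !scalerA mulVf ?gt_eqF// scale1r mulrA.
Qed.

(** Minimality against the slope along [v], taken at parameter 1, gives [q u <= q (u + v) - q v],
    the converse of subadditivity. Negative scalars then follow from [q (- u) = - q u]. *)
Lemma minimal_sublinear_linear (q : V -> R) : sublinear_on q ->
  (forall r, sublinear_on r -> (forall u, S u -> r u <= q u) ->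
     forall u, S u -> q u <= r u) ->
  (forall u v, S u -> S v -> q (u + v) = q u + q v) /\
  (forall l u, S u -> q (l *: u) = l * q u).
Proof.
move=> qs qmin.
have qD u v : S u -> S v -> q (u + v) = q u + q v.
  move=> Su Sv; apply/eqP; rewrite eq_le qs.1//=.
  have : q u <= sublinear_slope q v u.
    apply: qmin => //; first exact: sublinear_slope_sublinear.
    move=> w Sw; have := sublinear_slope_le qs Sv Sw (lexx 0).
    by rewrite scale0r addr0 mul0r subr0.
  move=> /le_trans /(_ (sublinear_slope_le qs Sv Su ler01)).
  rewrite scale1r; lra.
split=> // l u Su; have [l0|l0] := leP 0 l; first exact: qs.2.
have SNu : S (- u) by rewrite -scaleN1r; exact: SZ.
have qN : q (- u) = - q u.
  have := qD _ _ Su SNu; rewrite subrr (sublinear0 qs Su); lra.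
rewrite -(opprK l) scaleNr -scalerN qs.2// ?qN; last by rewrite oppr_ge0 ltW.
by rewrite mulrN !mulNr.
Qed.

(** Zorn's lemma on the sublinear minorants of [q]. Their common lower bound [- q (- u)] makes the
    pointwise infimum of a chain a true one. *)
Lemma exists_minimal_sublinear (q : V -> R) : sublinear_on q ->
  exists r, [/\ sublinear_on r, (forall u, S u -> r u <= q u) &
    forall s, sublinear_on s -> (forall u, S u -> s u <= r u) ->
     forall u, S u -> r u <= s u].
Proof.
move=> qs.
pose T := {r : V -> R | sublinear_on r /\ forall u, S u -> r u <= q u}.
(* The order is reversed, so that maximality for [le] is minimality of the functional. Values are
   compared on [S] only, which makes [le] a mere preorder. *)
pose le (r s : T) := `[< forall u, S u -> sval s u <= sval r u >].
have Tlb (r : T) u : S u -> - q (- u) <= sval r u.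
  move=> Su; have [rs rq] := svalP r.
  apply: le_trans (sublinearN_ge rs Su); rewrite lerN2.
  by apply: rq; rewrite -scaleN1r; exact: SZ.
have [||A Atot|r rmin] := @ZL_preorder T (exist _ q (conj qs (fun=> fun=> lexx _))) le.
- by move=> r; apply/asboolP => u Su; exact: lexx.
- move=> s r t /asboolP rs /asboolP st; apply/asboolP => u Su.
  exact: le_trans (st u Su) (rs u Su).
- have [->|/set0P[a Aa]] := eqVneq A set0.
    by exists (exist _ q (conj qs (fun=> fun=> lexx _))).
  pose m u := inf [set sval r u | r in A].
  have m_le r u : A r -> S u -> m u <= sval r u.
    move=> Ar Su; apply: ge_inf; last by exists r.
    by exists (- q (- u)) => _ [s As <-]; exact: Tlb.
  have m_ge c u : (forall r, A r -> c <= sval r u) -> c <= m u.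
    by move=> H; apply: lb_le_inf; [exists (sval a u), a|move=> _ [r Ar <-]; exact: H].
  have ms : sublinear_on m.
    split=> [u v Su Sv|l u l0 Su].
      rewrite -lerBlDr; apply: (@m_ge _ _) => r Ar.
      rewrite lerBlDr -lerBlDl; apply: (@m_ge _ _) => s As; rewrite lerBlDl.
      (* [r] and [s] arise from two independent infima; the smaller of them, which the chain
         provides, serves for both terms. *)
      have [/asboolP rs|/asboolP sr] := Atot _ _ Ar As.
        apply: (le_trans (m_le s _ As (SD Su Sv))).
        by apply: le_trans ((svalP s).1.1 _ _ Su Sv) _; rewrite lerD2r rs.
      apply: (le_trans (m_le r _ Ar (SD Su Sv))).
      by apply: le_trans ((svalP r).1.1 _ _ Su Sv) _; rewrite lerD2l sr.
    apply/eqP; rewrite eq_le; apply/andP; split; last first.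
      apply: (@m_ge _ _) => r Ar; rewrite (svalP r).1.2// ler_wpM2l//; exact: m_le.
    have [->|l_neq0] := eqVneq l 0.
      apply: (le_trans (m_le a _ Aa (SZ 0 Su))).
      by rewrite (svalP a).1.2// !mul0r.
    have {l_neq0} l_gt0 : 0 < l by rewrite lt_neqAle eq_sym l_neq0.
    rewrite -ler_pdivrMl//; apply: (@m_ge _ _) => r Ar; rewrite ler_pdivrMl//.
    by rewrite -(svalP r).1.2//; apply: m_le => //; exact: SZ.
  have mq u : S u -> m u <= q u.
    by move=> Su; apply: le_trans (m_le _ _ Aa Su) _; exact: (svalP a).2.
  by exists (exist _ m (conj ms mq)) => s As; apply/asboolP => u Su; exact: m_le.
have [rs rq] := svalP r.
exists (sval r); split=> // s ss sr.
have sq u : S u -> s u <= q u by move=> Su; exact: le_trans (sr u Su) (rq u Su).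
have := rmin (exist _ s (conj ss sq)); rewrite /le !asboolE; exact.
Qed.

Theorem hahn_banach (q : V -> R) (y : V) : sublinear_on q -> S y ->
  exists L : V -> R, [/\
    forall u v, S u -> S v -> L (u + v) = L u + L v,
    forall l u, S u -> L (l *: u) = l * L u,
    forall u, S u -> L u <= q u &
    L y = q y].
Proof.
move=> qs Sy.
have [L [Ls Lq Lmin]] :=
  exists_minimal_sublinear (sublinear_slope_sublinear qs Sy).
have [LD LZ] := minimal_sublinear_linear Ls Lmin.
have Lleq u : S u -> L u <= q u.
  move=> Su; apply: le_trans (Lq _ Su) _.
  have := sublinear_slope_le qs Sy Su (lexx 0).
  by rewrite scale0r addr0 mul0r subr0.
exists L; split=> //; apply/eqP; rewrite eq_le Lleq//=.
have SNy : S (- y) by rewrite -scaleN1r; exact: SZ.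
have := le_trans (Lq _ SNy) (sublinear_slope_le qs Sy SNy ler01).
rewrite scale1r addNr (sublinear0 qs Sy) -[in L _]scaleN1r LZ//; lra.
Qed.

End HahnBanach.

(** * Continuous functions on compact metric spaces *)

Lemma continuous_compact_bounded (R : realType) (X : topologicalType)
    (p : X -> R) : compact [set: X] -> continuous p ->
  exists M, 0 <= M /\ forall x, `|p x| <= M.
Proof.
move=> cX cp.
have : compact (p @` [set: X]).
  by apply: continuous_compact => //; exact: continuous_subspaceT.
move/compact_bounded => [M0 [_ /(_ (`|M0| + 1))]].
rewrite (le_lt_trans (ler_norm _)) ?ltrDl// => /(_ isT) pM.
by exists (`|M0| + 1); split=> [|x]; [rewrite addr_ge0|apply: pM; exists x].
Qed.

Lemma le_supnorm (R : realType) (X : topologicalType) (p : X -> R) x :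
  compact [set: X] -> continuous p -> `|p x| <= supnorm p.
Proof.
move=> cX cp; have [M [_ pM]] := continuous_compact_bounded cX cp.
by apply: ub_le_sup; [exists M => _ [y _ <-]|exists x].
Qed.

Lemma supnorm_ge0 (R : realType) (X : topologicalType) (p : X -> R) :
  compact [set: X] -> continuous p -> 0 <= supnorm p.
Proof.
move=> cX cp; have [[x _]|X0] := pselect (exists x : X, True).
  exact: le_trans (normr_ge0 _) (le_supnorm x cX cp).
(* On an empty space the supremum takes its default value 0. *)
have r0 : range (fun x => `|p x|) = set0.
  by rewrite -subset0 => r [y _ _]; apply: X0; exists y.
by rewrite /supnorm r0 sup0.
Qed.

(** [p] lies between the constants [- s] and [s], with [s] its supremum norm. Homogeneity covers
    nonnegative scalars only, so the values at 1 and at -1 are bounded separately. *)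
Lemma homogeneous_monotone_bound (R : realType) (X : topologicalType)
    (mu : (X -> R) -> R) (C : R) : compact [set: X] ->
  (forall (l : R) (p : X -> R), continuous p -> 0 <= l ->
     mu (fun x => l * p x) = l * mu p) ->
  (forall p q : X -> R, continuous p -> continuous q ->
     (forall x, p x <= q x) -> mu p <= mu q) ->
  `|mu (fun=> 1)| <= C -> `|mu (fun=> -1)| <= C ->
  forall p : X -> R, continuous p -> `|mu p| <= C * supnorm p.
Proof.
move=> cX muZ mu_le H1 HN1 p cp; set s := supnorm p.
have ps x : `|p x| <= s by exact: le_supnorm.
have s0 : 0 <= s by exact: supnorm_ge0.
have ccst (c : R) : continuous (fun _ : X => c) by exact: cst_continuous.
have mus : mu (fun=> s) = s * mu (fun=> 1).
  by rewrite -muZ//; congr mu; apply/funext => x; rewrite mulr1.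
have muNs : mu (fun=> - s) = s * mu (fun=> -1).
  by rewrite -muZ//; congr mu; apply/funext => x; rewrite mulrN1.
rewrite ler_norml; apply/andP; split.
  apply: (@le_trans _ _ (mu (fun=> - s))).
    rewrite muNs lerNl -mulrN mulrC ler_wpM2r//.
    by apply: le_trans HN1; rewrite -normrN; exact: ler_norm.
  by apply: mu_le => // x; have := ps x; rewrite ler_norml => /andP[].
apply: (@le_trans _ _ (mu (fun=> s))).
  by apply: mu_le => // x; apply: le_trans (ps x); exact: ler_norm.
by rewrite mus mulrC ler_wpM2r// (le_trans (ler_norm _) H1).
Qed.

Lemma dense_continuous_le (R : realType) (X : topologicalType) (D : set X)
    (p q : X -> R) : dense D -> continuous p -> continuous q ->
  (forall x, D x -> p x <= q x) -> forall x, p x <= q x.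
Proof.
move=> dD cp cq pq x; rewrite leNgt; apply/negP => qx.
have oU : open [set y | 0 < p y - q y].
  apply: (@open_comp _ _ (fun y => p y - q y) [set r | 0 < r]).
    by move=> y _; apply: cvgB; [exact: cp|exact: cq].
  exact: open_gt.
have [|y [/= qy Dy]] := dD [set y | 0 < p y - q y] _ oU.
  by exists x; rewrite /= subr_gt0.
by have := pq y Dy; rewrite leNgt -subr_gt0 qy.
Qed.

(** * Lipschitz regularization of functions bounded below *)

Section LipschitzEnvelope.
Context {R : realType} {X : metricType R}.
Variables (u : X -> R) (M : R).
Hypothesis uM : forall x, - M <= u x.

(** The inf-convolution of [u] with [k] times the distance, or Pasch-Hausdorff envelope: the largest
    [k]-Lipschitz minorant of [u]. *)
Definition lip_env (k : nat) (x : X) : R :=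
  inf (range (fun y => u y + k%:R * mdist x y)).

Lemma lip_env_le k x y : lip_env k x <= u y + k%:R * mdist x y.
Proof.
apply: ge_inf; last by exists y.
exists (- M) => _ [z _ <-]; apply: (le_trans (uM z)).
by rewrite lerDl mulr_ge0// mdist_ge0.
Qed.

Lemma lip_env_le_self k x : lip_env k x <= u x.
Proof. by have := lip_env_le k x x; rewrite mdistxx mulr0 addr0. Qed.

Lemma lip_env_ge k x c :
  (forall y, c <= u y + k%:R * mdist x y) -> c <= lip_env k x.
Proof.
move=> H; apply: lb_le_inf; last by move=> _ [y _ <-].
by exists (u x + k%:R * mdist x x), x.
Qed.

Lemma lip_env_lipschitz k x y : lip_env k x <= lip_env k y + k%:R * mdist x y.
Proof.
rewrite -lerBlDr; apply: lip_env_ge => z; rewrite lerBlDr.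
apply: (le_trans (lip_env_le k x z)); rewrite -addrA lerD2l -mulrDr.
by rewrite ler_wpM2l// addrC metric_triangle.
Qed.

Lemma lip_env_continuous k : continuous (lip_env k).
Proof.
move=> x; apply/cvgrPdist_lt => e e0.
(* Dividing by [k + 1] instead of [k] covers [k = 0]. *)
have k0 : 0 < k%:R + 1 :> R by rewrite ltr_wpDl.
near=> y.
have xy : mdist x y < e / (k%:R + 1).
  near: y; apply/nbhs_ballP; exists (e / (k%:R + 1)) => /=.
    by rewrite divr_gt0.
  by rewrite ballEmdist.
have : k%:R * mdist x y < e.
  apply: le_lt_trans (_ : (k%:R + 1) * mdist x y < e).
    by rewrite ler_wpM2r ?mdist_ge0// lerDl.
  by rewrite mulrC -ltr_pdivlMr.
apply: le_lt_trans; rewrite ler_norml.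
have := lip_env_lipschitz k x y; have := lip_env_lipschitz k y x.
rewrite (metric_sym y x); lra.
Unshelve. all: by end_near. Qed.

Lemma lip_env_nondecreasing k l x : (k <= l)%N -> lip_env k x <= lip_env l x.
Proof.
move=> kl; apply: lip_env_ge => y; apply: (le_trans (lip_env_le k x y)).
by rewrite lerD2l ler_wpM2r ?mdist_ge0// ler_nat.
Qed.

(* Away from [x] the penalty [k * d x y] beats the lower bound [- M]. *)
Lemma lip_env_approx x (e : R) : (\forall y \near x, u x - e <= u y) -> 0 < e ->
  exists K, forall k, (K <= k)%N -> u x - e <= lip_env k x.
Proof.
move=> /nbhs_ballP[d /= d0 xd] e0.
exists (Num.truncn ((u x + M) / d)).+1 => k Kk.
apply: lip_env_ge => y; have [xy|xy] := ltP (mdist x y) d.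
  have /xd/= : ball x d y by rewrite ballEmdist.
  move=> /le_trans; apply.
  by rewrite lerDl mulr_ge0// mdist_ge0.
have Kd : u x + M <= k%:R * d.
  rewrite -ler_pdivrMr//; apply: ltW; apply: lt_le_trans (truncnS_gt _) _.
  by rewrite ler_nat.
have := uM y; have : k%:R * d <= k%:R * mdist x y by rewrite ler_wpM2l.
lra.
Qed.

End LipschitzEnvelope.

(** A Dini-type principle: finitely many neighbourhoods cover [X], and a large enough [n] serves all
    of them. *)
Lemma compact_near_unif (X : topologicalType) (P : nat -> X -> Prop) :
  compact [set: X] ->
  (forall x : X, \forall y \near x & n \near \oo, P n y) ->
  exists n, forall x, P n x.
Proof.
move=> /compact_near_coveringP cX PX.
have [N _ NP] := cX nat \oo P eventually_filter (fun x _ => PX x).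
by exists N => x; exact: (NP N (leqnn N) x I).
Qed.

(** * Outer measure of a positive linear functional *)

Definition positive_linear (R : realType) (X : topologicalType)
    (L : (X -> R) -> R) : Prop :=
  [/\ forall p q : X -> R, continuous p -> continuous q ->
        L (fun x => p x + q x) = L p + L q,
      forall (l : R) (p : X -> R), continuous p ->
        L (fun x => l * p x) = l * L p &
      forall p : X -> R, continuous p -> (forall x, 0 <= p x) -> 0 <= L p].

Lemma continuousD_fun (R : realType) (X : topologicalType) (p q : X -> R) :
  continuous p -> continuous q -> continuous (fun x => p x + q x).
Proof. by move=> cp cq x; apply: cvgD; [exact: cp|exact: cq]. Qed.

Lemma continuousZ_fun (R : realType) (X : topologicalType) (l : R) (p : X -> R) :
  continuous p -> continuous (fun x => l * p x).
Proof. by move=> cp x; apply: cvgMr; exact: cp. Qed.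

Lemma continuous_minC (R : realType) (X : topologicalType) (p : X -> R) (c : R) :
  continuous p -> continuous (fun x => Num.min (p x) c).
Proof. by move=> cp x; apply: continuous_min; [exact: cp|exact: cvg_cst]. Qed.

Section RieszOuterMeasure.
Context {R : realType} {X : metricType R}.
Variable L : (X -> R) -> R.
Hypothesis cX : compact [set: X].
Hypothesis posL : positive_linear L.
Implicit Types (g p q : X -> R) (V W A : set X).

Let LD (p q : X -> R) (cp : continuous p) (cq : continuous q) :
  L (fun x => p x + q x) = L p + L q.
Proof. by case: posL => + _ _; exact. Qed.

Let LZ (l : R) (p : X -> R) (cp : continuous p) : L (fun x => l * p x) = l * L p.
Proof. by case: posL => _ + _; exact. Qed.

Lemma positive_linear_le (p q : X -> R) : continuous p -> continuous q ->
  (forall x, p x <= q x) -> L p <= L q.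
Proof.
move=> cp cq pq; have cB := continuousD_fun cq (continuousZ_fun (l := -1) cp).
have : 0 <= L (fun x => q x + -1 * p x).
  by case: posL => _ _; apply=> // x; rewrite mulN1r subr_ge0.
by rewrite LD ?LZ ?mulN1r ?subr_ge0//; exact: continuousZ_fun.
Qed.

Let c1 : continuous (fun _ : X => 1 : R).
Proof. exact: cst_continuous. Qed.

Let L1_ge0 : 0 <= L (fun=> 1).
Proof. by case: posL => _ _; apply. Qed.

Lemma positive_linear_cst (c : R) : L (fun=> c) = c * L (fun=> 1).
Proof. by rewrite -LZ//; congr L; apply/funext => x; rewrite mulr1. Qed.

(** Vanishing off [V] replaces the usual condition that the support lie inside [V]; Lipschitz
    envelopes of the indicator of [V] then qualify as they are. *)
Definition subordinate (V : set X) : set (X -> R) := [set g : X -> R |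
  [/\ continuous g, forall x, 0 <= g x <= 1 & forall x, ~ V x -> g x = 0]].

Definition riesz_content (V : set X) : R := sup [set L g | g in subordinate V].

Lemma subordinate0 V : subordinate V (fun=> 0).
Proof. by split=> // [|x]; [exact: cst_continuous|rewrite lexx ler01]. Qed.

Lemma subordinate_subset V W : V `<=` W -> subordinate V `<=` subordinate W.
Proof. by move=> VW g [cg g01 gV]; split=> // x Wx; apply: gV => /VW. Qed.

Lemma subordinate_le1 V g : subordinate V g -> L g <= L (fun=> 1).
Proof. by move=> [cg g01 _]; apply: positive_linear_le => // x; case/andP: (g01 x). Qed.

Lemma riesz_content_ge V g : subordinate V g -> L g <= riesz_content V.
Proof.
move=> Vg; apply: ub_le_sup; last by exists g.
by exists (L (fun=> 1)) => _ [h Vh <-]; exact: subordinate_le1 Vh.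
Qed.

Lemma riesz_content_le V c : (forall g, subordinate V g -> L g <= c) ->
  riesz_content V <= c.
Proof.
move=> H; apply: ge_sup; last by move=> _ [g Vg <-]; exact: H.
by exists (L (fun=> 0)), (fun=> 0) => //; exact: subordinate0.
Qed.

Lemma riesz_content_ge0 V : 0 <= riesz_content V.
Proof.
apply: le_trans (riesz_content_ge (subordinate0 V)).
by rewrite positive_linear_cst mul0r.
Qed.

Lemma riesz_contentS V W : V `<=` W -> riesz_content V <= riesz_content W.
Proof.
move=> VW; apply: riesz_content_le => g Vg.
by apply: riesz_content_ge; exact: subordinate_subset Vg.
Qed.

(** The indicator of an open set is lower semicontinuous, so its Lipschitz envelopes increase to
    it. *)
Lemma open_subordinate_approx (V : set X) : open V ->
  exists h : nat -> X -> R, [/\ forall k, subordinate V (h k),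
    forall k l x, (k <= l)%N -> h k x <= h l x &
    forall x e, V x -> 0 < e -> exists K, 1 - e <= h K x].
Proof.
move=> oV; pose u (x : X) : R := (x \in V)%:R.
have u0 x : - 0 <= u x by rewrite oppr0 ler0n.
exists (lip_env u); split=> [k|k l x|x e Vx e0].
- split=> [|x|x nVx]; first exact: (lip_env_continuous u0).
    apply/andP; split.
      by apply: lip_env_ge => y; rewrite addr_ge0 ?ler0n// mulr_ge0// mdist_ge0.
    by apply: (le_trans (lip_env_le_self u0 k x)); rewrite /u; case: (_ \in _).
  apply/eqP; rewrite eq_le; apply/andP; split.
    by apply: (le_trans (lip_env_le_self u0 k x)); rewrite /u memNset.
  by apply: lip_env_ge => y; rewrite addr_ge0 ?ler0n// mulr_ge0// mdist_ge0.
- exact: (lip_env_nondecreasing u0).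
- have ux : u x = 1 by rewrite /u mem_set.
  have [|K /(_ K (leqnn K))] := @lip_env_approx _ _ u 0 u0 x e _ e0.
    near=> y; have Vy : V y by near: y; exact: open_nbhs_nbhs.
    by rewrite /u !mem_set// lerBlDr lerDl ltW.
  by rewrite ux => ?; exists K.
Unshelve. all: by end_near. Qed.

Lemma continuous_sum_fun (f : nat -> X -> R) N : (forall n, continuous (f n)) ->
  continuous (fun x => \sum_(i < N) f i x).
Proof.
move=> cf; elim: N => [|N IH].
  under [X in continuous X]eq_fun do rewrite big_ord0.
  exact: cst_continuous.
under [X in continuous X]eq_fun do rewrite big_ord_recr /=.
exact: continuousD_fun.
Qed.

Lemma positive_linear_sum (f : nat -> X -> R) N : (forall n, continuous (f n)) ->
  L (fun x => \sum_(i < N) f i x) = \sum_(i < N) L (f i).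
Proof.
move=> cf; elim: N => [|N IH].
  under [X in L X]eq_fun do rewrite big_ord0.
  by rewrite big_ord0 positive_linear_cst mul0r.
under [X in L X]eq_fun do rewrite big_ord_recr /=.
by rewrite big_ord_recr /= -IH LD//; exact: continuous_sum_fun.
Qed.

(** Near each point [g] is eventually below [e] plus the sum of the first [N] approximants [h n N].
    Compactness gives one [N] for all points, and [L] is applied to the inequality. *)
Lemma subordinate_bigcup_le (V : nat -> set X) g (e : R) :
  (forall n, open (V n)) -> subordinate (\bigcup_n V n) g -> 0 < e ->
  exists N, L g <= e * L (fun=> 1) + \sum_(n < N) riesz_content (V n).
Proof.
move=> oV [cg g01 gV] e0.
have /choice[h hP] : forall n, exists h : nat -> X -> R,
    [/\ forall k, subordinate (V n) (h k),
    forall k l x, (k <= l)%N -> h k x <= h l x &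
    forall x e, V n x -> 0 < e -> exists K, 1 - e <= h K x].
  by move=> n; exact: open_subordinate_approx.
have ch n k : continuous (h n k) by case: (hP n) => /(_ k) [].
have h0 n k x : 0 <= h n k x.
  by case: (hP n) => /(_ k) [_ /(_ x)/andP[]].
have cS N k : continuous (fun x => e + \sum_(n < N) h n k x).
  apply: continuousD_fun; first exact: cst_continuous.
  exact: (@continuous_sum_fun (fun n => h n k)).
have [|N gN] := @compact_near_unif X (fun N x => g x <= e + \sum_(n < N) h n N x) cX.
  move=> x.
  have [N gN] : exists N, g x < e + \sum_(n < N) h n N x.
    have [[n _ Vnx]|nVx] := pselect ((\bigcup_n V n) x); last first.
      by exists 0; rewrite gV// big_ord0 addr0.
    have [_ hmono /(_ x (e / 2) Vnx)] := hP n.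
    rewrite divr_gt0// => /(_ isT)[K hK].
    have leN : (n < (n + K).+1)%N by rewrite ltnS leq_addr.
    (* This index exceeds [n], so the term [h n] occurs in the sum, and exceeds [K], so that term is
       at least [1 - e / 2]. *)
    exists (n + K).+1; rewrite (bigD1 (Ordinal leN))//=.
    have hK' : h n K x <= h n (n + K).+1 x by apply: hmono; lia.
    have : 0 <= \sum_(i < (n + K).+1 | i != Ordinal leN) h i (n + K).+1 x.
      by apply: sumr_ge0.
    have /andP[_ g1] := g01 x; lra.
  have oN : open [set y | 0 < e + \sum_(n < N) h n N y - g y].
    apply: (@open_comp _ _ (fun y => e + \sum_(n < N) h n N y - g y) [set r | 0 < r]).
      by move=> y _; apply: cvgB; [exact: cS|exact: cg].
    exact: open_gt.
  near=> y M; rewrite /=.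
  have NM : (N <= M)%N by near: M; exists N.
  have : 0 < e + \sum_(n < N) h n N y - g y.
    near: y; apply: open_nbhs_nbhs; split; first exact: oN.
    by rewrite /= subr_gt0.
  (* From [N] to [M] both the number of terms and each single term grow. *)
  have : \sum_(n < N) h n N y <= \sum_(n < M) h n M y.
    rewrite -(big_mkord xpredT (fun n => h n N y)).
    rewrite -(big_mkord xpredT (fun n => h n M y)) [leRHS](big_cat_nat _ (n := N))//=.
    rewrite -[leLHS]addr0 lerD ?sumr_ge0//; apply: ler_sum => n _.
    by have [_ + _] := hP n; apply.
  lra.
exists N.
apply: (@le_trans _ _ (L (fun x => e + \sum_(n < N) h n N x))).
  exact: positive_linear_le.
rewrite LD; last 2 first.
- exact: cst_continuous.
- exact: (@continuous_sum_fun (fun n => h n N)).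
rewrite positive_linear_cst lerD2l (@positive_linear_sum (fun n => h n N))//.
apply: ler_sum => n _; apply: riesz_content_ge; by case: (hP n).
Unshelve. all: by end_near. Qed.

Lemma riesz_content_bigcup (V : nat -> set X) : (forall n, open (V n)) ->
  ((riesz_content (\bigcup_n V n))%:E <= \sum_(n <oo) (riesz_content (V n))%:E)%E.
Proof.
move=> oV.
have Lg g : subordinate (\bigcup_n V n) g ->
    ((L g)%:E <= \sum_(n <oo) (riesz_content (V n))%:E)%E.
  move=> gV; apply/lee_addgt0Pr => e e0.
  (* The added 1 allows division when [L (fun=> 1)] vanishes. *)
  have L1 : 0 < L (fun=> 1) + 1 by rewrite ltr_wpDl.
  have [N LgN] := subordinate_bigcup_le oV gV (divr_gt0 e0 L1).
  apply: (@le_trans _ _ (\sum_(0 <= n < N) (riesz_content (V n))%:E + e%:E)%E).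
    rewrite big_mkord sumEFin -EFinD lee_fin (le_trans LgN)// addrC lerD2l.
    rewrite -[leRHS](divfK (lt0r_neq0 L1)) ler_wpM2l ?lerDl// divr_ge0// ltW//.
  rewrite leeD2r//; apply: nneseries_lim_ge => n _ _.
  by rewrite lee_fin riesz_content_ge0.
(* The content is a real supremum, so the bounds on [L g] pass to it when the series is finite. An
   infinite sum is trivial, and minus infinity is excluded by [g = 0]. *)
move: Lg; case: (\sum_(n <oo) _)%E => [r| |] Lg.
- by rewrite lee_fin; apply: riesz_content_le => g /Lg; rewrite lee_fin.
- exact: leey.
- by have := Lg _ (subordinate0 _).
Qed.

Definition riesz_outer (A : set X) : R :=
  inf [set riesz_content V | V in [set V | open V /\ A `<=` V]].

Lemma riesz_outer_le A V : open V -> A `<=` V -> riesz_outer A <= riesz_content V.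
Proof.
move=> oV AV; apply: ge_inf; last by exists V.
by exists 0 => _ [W _ <-]; exact: riesz_content_ge0.
Qed.

Lemma riesz_outer_ge A c :
  (forall V, open V -> A `<=` V -> c <= riesz_content V) -> c <= riesz_outer A.
Proof.
move=> H; apply: lb_le_inf; last by move=> _ [V [oV AV] <-]; exact: H.
by exists (riesz_content setT), setT => //; split=> //; exact: openT.
Qed.

Lemma riesz_outer_ge0 A : 0 <= riesz_outer A.
Proof. by apply: riesz_outer_ge => V _ _; exact: riesz_content_ge0. Qed.

Lemma riesz_outer0 : riesz_outer set0 = 0.
Proof.
apply/eqP; rewrite eq_le riesz_outer_ge0 andbT.
apply: (le_trans (riesz_outer_le open0 (@subset_refl _ set0))).
apply: riesz_content_le => g [cg g01 g0].
have -> : g = fun=> 0 by apply/funext => x; rewrite g0.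
by rewrite positive_linear_cst mul0r.
Qed.

Lemma riesz_outerS A B : A `<=` B -> riesz_outer A <= riesz_outer B.
Proof.
by move=> AB; apply: riesz_outer_ge => V oV BV; apply: riesz_outer_le => // x /AB/BV.
Qed.

Lemma riesz_outer_adherent A (e : R) : 0 < e ->
  exists V, [/\ open V, A `<=` V & riesz_content V <= riesz_outer A + e].
Proof.
move=> e0; apply: contrapT => H.
suff : riesz_outer A + e <= riesz_outer A by lra.
apply: riesz_outer_ge => V oV AV; rewrite leNgt; apply/negP => Ve.
by apply: H; exists V; split=> //; exact: ltW.
Qed.

(** Each [F n] is covered by an open set up to an error [e / 2 ^ n.+1], and the contents of these
    open sets are countably subadditive. *)
Lemma riesz_outer_sigma_subadditive :
  sigma_subadditive (fun A => (riesz_outer A)%:E).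
Proof.
move=> F; apply/lee_addgt0Pr => e e0.
have /choice[V VP] : forall n, exists V, [/\ open V, F n `<=` V &
    riesz_content V <= riesz_outer (F n) + e / (2 ^ n.+1)%:R].
  by move=> n; apply: riesz_outer_adherent; rewrite divr_gt0// ltr0n expn_gt0.
have oV n : open (V n) by case: (VP n).
apply: (@le_trans _ _ (\sum_(n <oo) (riesz_content (V n))%:E)%E).
  apply: le_trans (riesz_content_bigcup oV); rewrite lee_fin.
  apply: riesz_outer_le; first exact: bigcup_open.
  by apply: subset_bigcup => n _; case: (VP n).
apply: le_trans (@epsilon_trick _ _ e xpredT _ _); last exact: ltW.
  apply: lee_nneseries => n _; first by rewrite lee_fin riesz_content_ge0.
  by rewrite -EFinD lee_fin; case: (VP n).
by move=> n; rewrite lee_fin riesz_outer_ge0.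
Qed.

(* [W] is split by a function [g] subordinate to [W `&` V] into [W `&` V] and
   the open set [W `&` [set x | g x < e]], which contains [W `\` V]; subordinate
   functions of the two pieces add up to at most [1 + e]. *)
Lemma riesz_content_split (V W : set X) : open V -> open W ->
  riesz_content (W `&` V) + riesz_outer (W `&` ~` V) <= riesz_content W.
Proof.
move=> oV oW; rewrite -lerBrDr; apply: riesz_content_le => g [cg g01 gWV].
rewrite lerBrDr; apply/ler_addgt0Pr => e e0.
have cW : 0 < riesz_content W + 1 by rewrite ltr_wpDl// riesz_content_ge0.
(* Chosen so that [d * riesz_content W <= e], also when the content is 0. *)
pose d := e / (riesz_content W + 1).
have d0 : 0 < d by rewrite divr_gt0.
pose W' := W `&` [set x | g x < d].
have oW' : open W'.
  apply: openI => //; apply: (@open_comp _ _ g [set r : R | r < d]).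
    by move=> x _; exact: cg.
  exact: open_lt.
suff : L g + riesz_content W' <= (1 + d) * riesz_content W.
  have : riesz_outer (W `&` ~` V) <= riesz_content W'.
    apply: riesz_outer_le => // x [Wx nVx]; split=> //=.
    by rewrite gWV// => -[].
  have : d * riesz_content W <= e.
    by rewrite /d mulrAC ler_pdivrMr// ler_wpM2l ?lerDl// ltW.
  lra.
rewrite -lerBrDl; apply: riesz_content_le => h [ch h01 hW'].
rewrite lerBrDl -ler_pdivrMl ?addr_gt0// mulrDr -!LZ// -LD; try exact: continuousZ_fun.
have d1 : 0 < 1 + d by rewrite addr_gt0.
(* The scaled sum is subordinate to [W]: where [g x < d] the sum is at most [d + 1], and elsewhere
   [h] vanishes. *)
apply: riesz_content_ge; split=> [|x|x nWx].
- by apply: continuousD_fun; exact: continuousZ_fun.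
- have /andP[g0 g1] := g01 x; have /andP[h0 h1] := h01 x.
  rewrite -mulrDr mulr_ge0 ?addr_ge0 ?invr_ge0 ?(ltW d1)//= ler_pdivrMl// mulr1.
  have [gd|gd] := ltP (g x) d; first by lra.
  by rewrite hW' ?addr0; [lra|move=> [_ /=]; rewrite ltNge gd].
- by rewrite gWV ?hW' ?mulr0 ?addr0// => -[].
Qed.

(** Carathéodory's criterion for open [V]: the splitting of an open [W] containing [A] is restricted
    to [A] by monotonicity, before the infimum over [W]. *)
Lemma riesz_outer_open_split (V A : set X) : open V ->
  riesz_outer (A `&` V) + riesz_outer (A `&` ~` V) <= riesz_outer A.
Proof.
move=> oV; apply: riesz_outer_ge => W oW AW.
apply: le_trans (riesz_content_split oV oW); apply: lerD.
  by apply: riesz_outer_le; [exact: openI|apply: setSI].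
by apply: riesz_outerS; apply: setSI.
Qed.

End RieszOuterMeasure.

(** * Integration against finite Borel measures *)

Section BorelIntegral.
Context {R : realType} {X : topologicalType} {x0 : X}.
Variable mu : {finite_measure set @BorelSpace X x0 -> \bar R}.
Hypothesis cX : compact [set: X].

Lemma open_borel_measurable (V : set X) : open V ->
  measurable (V : set (@BorelSpace X x0)).
Proof. by move=> oV; exact: sub_gen_smallest. Qed.

Lemma continuous_borel_measurable (p : X -> R) : continuous p ->
  measurable_fun setT (p : @BorelSpace X x0 -> R).
Proof.
move=> /continuousP cp; apply: (measurability _ (RGenOInfty.measurableE R)).
move=> _ [_ [a ->] <-]; rewrite setTI.
by apply: open_borel_measurable; apply: cp; exact: interval_open.
Qed.

Lemma continuous_integrable (p : X -> R) : continuous p ->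
  mu.-integrable setT (fun x => (p x)%:E).
Proof.
move=> cp; have [M [_ pM]] := continuous_compact_bounded cX cp.
apply: measurable_bounded_integrable => //.
- by rewrite -ge0_fin_numE//; exact: fin_num_measure.
- exact: continuous_borel_measurable.
- by exists M; split; [exact: num_real|move=> N MN x _ /=; exact: le_trans (ltW MN)].
Qed.

Lemma meas_smE (p : X -> R) : continuous p ->
  ((meas_sm mu p)%:E = \int[mu]_x (p x)%:E)%E.
Proof.
by move=> cp; rewrite /meas_sm fineK//; apply: integrable_fin_num => //;
  exact: continuous_integrable.
Qed.

Lemma meas_sm_positive_linear : positive_linear (meas_sm mu).
Proof.
split=> [p q cp cq|l p cp|p cp p0].
- by apply: RintegralD => //; exact: continuous_integrable.
- by apply: RintegralZl => //; exact: continuous_integrable.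
- by apply: Rintegral_ge0.
Qed.

Lemma meas_sm_SMplus : SMplus (meas_sm mu).
Proof.
have [ID IZ _] := meas_sm_positive_linear.
have I_le (p q : X -> R) : continuous p -> continuous q ->
    (forall x, p x <= q x) -> meas_sm mu p <= meas_sm mu q.
  move=> cp cq pq; apply: le_Rintegral => //; exact: continuous_integrable.
split=> //; split=> [p q cp cq|l p cp l0|].
- by rewrite ID.
- by rewrite IZ.
exists (Num.max `|meas_sm mu (fun=> 1)| `|meas_sm mu (fun=> -1)|).
apply: homogeneous_monotone_bound => // [l p cp l0||].
- by rewrite IZ.
- by rewrite le_max lexx.
- by rewrite le_max lexx orbT.
Qed.

Lemma meas_sm_cst1 : meas_sm mu (fun=> 1) = fine (mu setT).
Proof. by rewrite /meas_sm integral_cst// mul1e. Qed.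

(** This is the estimate of integrals by measures of open sets that the slicing argument
    requires. *)
Lemma meas_sm_indic_le (V : set X) (p : X -> R) (c : R) : open V ->
  continuous p -> (forall x, p x <= c * (x \in V)%:R) ->
  meas_sm mu p <= c * fine (mu V).
Proof.
move=> oV cp pV; have mV := open_borel_measurable oV.
have -> : fine (mu V) = (\int[mu]_x (\1_V x : R))%R.
  by rewrite /Rintegral integral_indic// setIT.
have iV : mu.-integrable setT (EFin \o (\1_V : _ -> R)).
  by apply: integrable_indic.
rewrite -RintegralZl//; apply: le_Rintegral => //.
- exact: continuous_integrable.
- exact: (integrableZl measurableT c iV).
Qed.

End BorelIntegral.

(* The continuous majorants [- lip_env] of [phi \o f] decrease to it on [D]. *)
Lemma cvg_majorants (R : realType) (X : metricType R) (x0 : X)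
    (mu : {finite_measure set @BorelSpace X x0 -> \bar R}) (D : set X)
    (h : X -> R) (M : R) :
  compact [set: X] -> open D -> (forall x, D x -> {for x, continuous h}) ->
  0 <= M ->
  (forall x, D x -> `|h x| <= M) -> exists psi : nat -> X -> R,
  [/\ forall n, continuous (psi n), forall n x, D x -> h x <= psi n x,
    mu.-integrable D (fun x => (h x)%:E) &
    (\int[mu]_(x in D) (psi n x)%:E @[n --> \oo] --> \int[mu]_(x in D) (h x)%:E)%E].
Proof.
move=> cX oD ch M0 hM.
have mD : measurable (D : set (@BorelSpace X x0)) by exact: open_borel_measurable.
(* The filler [M] off [D] keeps [u] within [- M] and [M]. As [D] is open, convergence at a point of
   [D] only sees the values [- h] nearby. *)
pose u x := if x \in D then - h x else M.
have uD x : D x -> u x = - h x by move=> Dx; rewrite /u mem_set.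
have uM x : - M <= u x.
  have [Dx|nDx] := pselect (D x).
    by rewrite uD// lerN2 (le_trans (ler_norm _)) ?hM.
  by rewrite /u memNset// (le_trans _ M0)// oppr_le0.
have uM' x : u x <= M.
  have [Dx|nDx] := pselect (D x).
    by rewrite uD// (le_trans (ler_norm _))// normrN hM.
  by rewrite /u memNset.
have cpsi n : continuous (fun x => - lip_env u n x).
  by move=> x; apply: cvgN; exact: (lip_env_continuous uM).
have psi_cvg x : D x -> (fun n => - lip_env u n x) @ \oo --> h x.
  move=> Dx; apply/cvgrPdist_le => e e0.
  have [|K KP] := @lip_env_approx _ _ u M uM x e _ e0.
    have := ch x Dx => /cvgrPdist_le /(_ e e0) hx.
    near=> y; have Dy : D y by near: y; exact: open_nbhs_nbhs.
    rewrite !uD//; have : `|h x - h y| <= e by near: y.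
    rewrite ler_norml; lra.
  exists K => // n /= /KP; have := lip_env_le_self uM n x.
  by rewrite uD// opprK ler_norml; lra.
have epsi_cvg x : D x -> (fun n => (- lip_env u n x)%:E) @ \oo --> (h x)%:E.
  by move=> Dx; apply: cvg_EFin; [exact: nearW|exact: psi_cvg].
have mpsi n : measurable_fun (D : set (@BorelSpace X x0)) (fun x => - lip_env u n x).
  by apply: measurable_funTS; exact: continuous_borel_measurable.
have mh : measurable_fun (D : set (@BorelSpace X x0)) (fun x => (h x)%:E).
  apply: (@emeasurable_fun_cvg _ (@BorelSpace X x0) R D (fun n x => (- lip_env u n x)%:E)).
    by move=> n; exact/measurable_EFinP.
  by move=> x Dx; exact: epsi_cvg.
have [|||||ih _ cvgh] := @dominated_convergence _ _ _ mu _ mD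
  (fun n x => (- lip_env u n x)%:E) (fun x => (h x)%:E) (cst M%:E).
- by move=> n; exact/measurable_EFinP.
- by [].
- by apply: aeW => x; exact: epsi_cvg.
- exact: finite_measure_integrable_cst.
- apply: aeW => x n Dx; rewrite lee_fin normrN ler_norml; apply/andP; split.
    apply: lip_env_ge => y; apply: (le_trans (uM y)).
    by rewrite lerDl mulr_ge0// mdist_ge0.
  exact: le_trans (lip_env_le_self uM n x) (uM' x).
exists (fun n x => - lip_env u n x); split=> // n x Dx.
by rewrite lerNr -uD//; exact: (lip_env_le_self uM).
Unshelve. all: by end_near. Qed.

(** * Riesz representation *)

Lemma min_slice_bounds (R : realDomainType) (p a b : R) : a <= b ->
  0 <= Num.min p b - Num.min p a <= b - a.
Proof. by move=> ab; rewrite !minEle; do 2 case: (leP p _) => ?; lra. Qed.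

(** * Comparison of two positive functionals by slicing functions into layers *)

Section Slicing.
Context {R : realType} {X : metricType R}.
Variables I L : (X -> R) -> R.
Hypothesis cX : compact [set: X].
Hypothesis posI : positive_linear I.
Hypothesis posL : positive_linear L.
Hypothesis IL1 : I (fun=> 1) = L (fun=> 1).
Hypothesis I_content : forall (V : set X) (p : X -> R) (c : R), open V ->
  continuous p -> (forall x, p x <= c * (x \in V)%:R) ->
  I p <= c * riesz_content L V.

(* [p] is the sum of the slices [d i] of height [w = 1 / n.+1]; the slice
   [d i.+1] is carried by the open set where [p > i.+1 * w], on which [d i]
   is already equal to [w]. *)
Lemma slicing_le (p : X -> R) n : continuous p -> (forall x, 0 <= p x <= 1) ->
  I p <= n.+1%:R^-1 * L (fun=> 1) + L p.
Proof.
move=> cp p01; set w : R := n.+1%:R^-1.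
have w0 : 0 <= w by rewrite invr_ge0.
pose s i : R := i%:R * w.
have sS i : s i.+1 = s i + w by rewrite /s -natr1 mulrDl mul1r.
have sle i : s i <= s i.+1 by rewrite sS lerDl.
pose d i x := Num.min (p x) (s i.+1) - Num.min (p x) (s i).
have d0 i x : 0 <= d i x by case/andP: (min_slice_bounds (p x) (sle i)).
have dw i x : d i x <= w.
  by case/andP: (min_slice_bounds (p x) (sle i)) => _; rewrite {2}sS -/(d i x); lra.
have cd i : continuous (d i).
  by move=> x; apply: cvgB; exact: continuous_minC.
have pE : p = fun x => \sum_(i < n.+1) d i x.
  apply/funext => x; rewrite -(big_mkord xpredT (fun i => d i x)) /d.
  rewrite (telescope_sumr (fun i => Num.min (p x) (s i)))//.
  have -> : s n.+1 = 1 by rewrite /s /w divff.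
  have -> : s 0%N = 0 by rewrite /s mul0r.
  by case/andP: (p01 x) => /min_idPr -> /min_idPl ->; rewrite subr0.
(* The sums are compared with a shift by one: on the side of [I] the bottom slice is bounded by the
   constant [w], and on the side of [L] the top slice is dropped as nonnegative. *)
rewrite {1}pE (positive_linear_sum posI)// big_ord_recl lerD//.
  rewrite -IL1 -(positive_linear_cst posI) -/w.
  by apply: (positive_linear_le posI) => //; exact: cst_continuous.
rewrite [X in _ <= L X]pE (positive_linear_sum posL)// big_ord_recr/= -[leLHS]addr0 lerD//; last first.
  by case: posL => _ _; apply.
  apply: ler_sum => i _; rewrite /bump leq0n add1n.
  pose V := [set x | s i.+1 < p x].
  have oV : open V.
    by apply: (@open_comp _ _ p [set r : R | s i.+1 < r]) => [x _|]; [exact: cp|exact: open_gt].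
  apply: le_trans (I_content (V := V) (c := w) oV _ _) _ => //.
    move=> x; have [Vx|nVx] := pselect (V x); first by rewrite mem_set// mulr1.
    rewrite memNset// mulr0 /d subr_le0 minEle ifT; last first.
      by rewrite sS (le_trans _ (ler_wpDr w0 (lexx _)))// leNgt; apply/negP.
    by rewrite minEle ifT// leNgt; apply/negP.
  have [->|w_neq0] := eqVneq w 0.
    by rewrite mul0r; case: posL => _ _; apply.
  have w_gt0 : 0 < w by rewrite lt_neqAle eq_sym w_neq0.
  rewrite -ler_pdivlMl//; apply: riesz_content_le => g [cg g01 gV].
  rewrite ler_pdivlMl//; have [_ LZ _] := posL; rewrite -LZ//.
  apply: (positive_linear_le posL) => //; first exact: continuousZ_fun.
  move=> x; have [Vx|nVx] := pselect (V x); last by rewrite gV// mulr0.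
  apply: (@le_trans _ _ w).
    by rewrite ler_piMr//; case/andP: (g01 x).
  have spx : s i.+1 < p x := Vx.
  have sipx : s i <= p x by apply: le_trans (sle i) (ltW spx).
  rewrite /d; move/ltW/min_idPr: spx => ->; move/min_idPr: sipx => ->.
  by rewrite sS; lra.
Qed.

Lemma slicing_unit_le (p : X -> R) : continuous p ->
  (forall x, 0 <= p x <= 1) -> I p <= L p.
Proof.
move=> cp p01; apply/ler_addgt0Pl => e e0.
have L1 : 0 <= L (fun=> 1).
  by case: posL => _ _; apply => //; exact: cst_continuous.
pose n := Num.truncn (L (fun=> 1) / e).
apply: le_trans (slicing_le n cp p01) _; rewrite lerD2r ler_pdivrMl//.
by rewrite mulrC -ler_pdivrMl// mulrC ltW// truncnS_gt.
Qed.

(** An affine change brings [p] into the unit interval. The added constant cancels because [I] and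
    [L] agree on constants. *)
Lemma slicing_general_le (p : X -> R) : continuous p -> I p <= L p.
Proof.
move=> cp; have [M0 [M0_ge0 pM0]] := continuous_compact_bounded cX cp.
pose M := M0 + 1; have M_gt0 : 0 < M by rewrite ltr_wpDl.
have pM x : `|p x| <= M by rewrite (le_trans (pM0 x))// lerDl.
have cM : continuous (fun _ : X => M) by exact: cst_continuous.
have c2M : 0 < 2 * M by rewrite mulr_gt0.
have cpM := continuousD_fun cp cM.
have : I (fun x => (2 * M)^-1 * (p x + M)) <= L (fun x => (2 * M)^-1 * (p x + M)).
  apply: slicing_unit_le => [|x]; first exact: continuousZ_fun.
  have := pM x; rewrite ler_norml => /andP[pMl pMr].
  rewrite mulr_ge0 ?invr_ge0 ?(ltW c2M)//=; last lra.
  by rewrite ler_pdivrMl//; lra.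
have [ID IZ _] := posI; have [LD LZ _] := posL.
rewrite IZ// LZ// ler_pM2l ?invr_gt0// ID// LD//.
by rewrite (positive_linear_cst posI) (positive_linear_cst posL) IL1 lerD2r.
Qed.

(** Linearity turns the inequality for [- p] into the reverse one, so the one-sided estimate
    [I_content] is enough. *)
Lemma slicing_eq (p : X -> R) : continuous p -> I p = L p.
Proof.
move=> cp; apply/eqP; rewrite eq_le slicing_general_le//=.
have := slicing_general_le (continuousZ_fun (l := -1) cp).
have [_ IZ _] := posI; have [_ LZ _] := posL.
by rewrite IZ// LZ// !mulN1r lerN2.
Qed.

End Slicing.

(** Open sets, hence Borel sets, are Carathéodory measurable for [riesz_outer L]. The resulting
    measure equals the content on open sets, and slicing identifies its integral with [L]. *)
Theorem riesz_representation (R : realType) (X : metricType R) (x0 : X)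
    (L : (X -> R) -> R) : compact [set: X] -> positive_linear L ->
  exists chi : {finite_measure set @BorelSpace X x0 -> \bar R},
    forall p : X -> R, continuous p -> meas_sm chi p = L p.
Proof.
move=> cX posL.
pose T := @borelT X x0.
pose outer (A : set T) := (riesz_outer L (A : set X))%:E.
have outer_ge0 A : (0 <= outer A)%E by rewrite lee_fin; exact: riesz_outer_ge0.
have outer0 : outer set0 = 0%E by rewrite /outer (riesz_outer0 posL).
have outerS : {homo outer : A B / A `<=` B >-> (A <= B)%E}.
  by move=> A B AB; rewrite lee_fin; exact: riesz_outerS.
have outer_sub : sigma_subadditive outer by exact: (riesz_outer_sigma_subadditive cX posL).
pose om : {outer_measure set T -> \bar R} :=
  HB.pack outer (isOuterMeasure.Build R T outer outer0 outer_ge0 outerS outer_sub).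
have borel_cara (A : set T) :
    measurable (A : set (@BorelSpace X x0)) -> caratheodory_measurable om A.
  suff : @measurable _ (@BorelSpace X x0) `<=`
      @measurable _ (caratheodory_type om) by exact.
  apply: smallest_sub; first exact: sigma_algebra_measurable.
  move=> V oV; apply: le_caratheodory_measurable => B /=.
  by rewrite /outer -EFinD lee_fin; exact: riesz_outer_open_split.
pose chi0 (A : set (@BorelSpace X x0)) := outer A.
have chi0_sigma : semi_sigma_additive chi0.
  move=> F mF tF mUF; apply: (@caratheodory_measure_sigma_additive _ _ om) => //.
    by move=> i; exact: borel_cara.
  exact: borel_cara.
have chi0_fin : fin_num_fun chi0 by [].
pose mchi := isMeasure.Build _ _ _ chi0 outer0 outer_ge0 chi0_sigma.
pose chi1 : {measure set @BorelSpace X x0 -> \bar R} := HB.pack chi0 mchi.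
pose chi : {finite_measure set @BorelSpace X x0 -> \bar R} :=
  HB.pack chi0 mchi (Measure_isFinite.Build _ _ _ chi1 chi0_fin).
have chi_open V : open V -> fine (chi V) = riesz_content L V.
  move=> oV; apply/eqP; rewrite eq_le; apply/andP; split.
    exact: riesz_outer_le.
  by apply: riesz_outer_ge => W oW VW; exact: (riesz_contentS posL).
exists chi; apply: slicing_eq => //; first exact: meas_sm_positive_linear.
  (* The total masses agree, since the constant 1 is the largest function subordinate to the whole
     space. *)
  rewrite meas_sm_cst1 chi_open; last exact: openT.
  apply/eqP; rewrite eq_le; apply/andP; split.
    by apply: riesz_content_le => // g; exact: subordinate_le1.
  apply: riesz_content_ge => //; split=> [|x|x []//]; first exact: cst_continuous.
  by rewrite ler01 lexx.
by move=> V p c oV cp pV; rewrite -chi_open//; exact: meas_sm_indic_le.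
Qed.

(** * Positive strong submeasures *)

Definition bounded_on (R : realType) (X : topologicalType) (D : set X)
    (h : X -> R) : Prop :=
  exists M, 0 <= M /\ forall x, D x -> `|h x| <= M.

(** At a point [x] off [D], the open set where [psi] is below [psi x + e] bounds the upper limit by
    [psi x + e]. Density and boundedness make the suprema and the infimum in [Eext] true ones. *)
Lemma Eext_le (R : realType) (X : topologicalType) (D : set X) (g psi : X -> R) :
  dense D -> bounded_on D g -> continuous psi ->
  (forall x, Eext D g x <= psi x) <-> (forall x, D x -> g x <= psi x).
Proof.
move=> dD [M [M0 gM]] cpsi; split=> [H x Dx|H x].
  by have := H x; rewrite /Eext; case: pselect.
rewrite /Eext; case: pselect => [Dx|nDx]; first exact: H.
have supV V : open_nbhs x V -> (g @` (V `&` D)) !=set0.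
  move=> [oV Vx]; have [|y Vy] := dD V _ oV; first by exists x.
  by exists (g y), y.
apply/ler_addgt0Pr => e e0.
pose V := [set y | psi y < psi x + e].
have oV : open_nbhs x V.
  split; last by rewrite /V /= ltrDl.
  by apply: (@open_comp _ _ psi [set r : R | r < psi x + e]) => [y _|];
    [exact: cpsi|exact: open_lt].
apply: (@le_trans _ _ (sup (g @` (V `&` D)))); last first.
  apply: ge_sup; first exact: supV.
  by move=> _ [y [Vy Dy] <-]; apply: le_trans (H y Dy) (ltW _).
apply: ge_inf; last by exists V.
exists (- M) => _ [W oW <-]; have [_ [y WDy _]] := supV W oW.
apply: (@le_trans _ _ (g y)).
  by have := gM y WDy.2; rewrite ler_norml => /andP[].
apply: ub_le_sup; last by exists y.
by exists M => _ [z [_ Dz] <-]; apply: le_trans (gM z Dz); exact: ler_norm.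
Qed.

Section PositiveSubmeasure.
Context {R : realType} {X : metricType R}.
Variable mu : (X -> R) -> R.
Hypothesis cX : compact [set: X].
Hypothesis muP : SMplus mu.

Lemma SMplusD (p q : X -> R) : continuous p -> continuous q ->
  mu (fun x => p x + q x) <= mu p + mu q.
Proof. by case: muP => -[+ _ _] _; exact. Qed.

Lemma SMplusZ (l : R) (p : X -> R) : continuous p -> 0 <= l ->
  mu (fun x => l * p x) = l * mu p.
Proof. by case: muP => -[_ + _] _; exact. Qed.

Lemma SMplus_le (p q : X -> R) : continuous p -> continuous q ->
  (forall x, p x <= q x) -> mu p <= mu q.
Proof. by case: muP => _; exact. Qed.

Let ccst (c : R) : continuous (fun _ : X => c).
Proof. exact: cst_continuous. Qed.

Lemma SMplus0 : mu (fun=> 0) = 0.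
Proof.
rewrite -[RHS](mul0r (mu (fun=> 1))) -SMplusZ//; congr mu.
by apply/funext => x; rewrite mul0r.
Qed.

(** The norm thus depends only on the values at 1 and -1, which the pushforward preserves. *)
Lemma SMplus_bound_iff C : 0 <= C ->
  (forall p : X -> R, continuous p -> `|mu p| <= C * supnorm p) <->
  `|mu (fun=> 1)| <= C /\ `|mu (fun=> -1)| <= C.
Proof.
move=> C0; split=> [H|[H1 HN1] p cp].
  (* Only an inequality, since constants have norm 0 on an empty space. *)
  have sup1 (c : R) : `|c| = 1 -> C * supnorm (fun _ : X => c) <= C.
    move=> c1; rewrite ler_piMr//; rewrite /supnorm.
    have [[x _]|X0] := pselect (exists x : X, True).
      by apply: ge_sup; [exists `|c|, x|move=> _ [y _ <-]; rewrite c1].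
    rewrite (_ : range _ = set0) ?sup0//.
    by rewrite -subset0 => r [y _ _]; apply: X0; exists y.
  split.
    exact: le_trans (H _ (@ccst 1)) (sup1 _ (normr1 _)).
  exact: le_trans (H _ (@ccst (-1))) (sup1 _ (normrN1 _)).
by apply: homogeneous_monotone_bound => //; [exact: SMplusZ|exact: SMplus_le].
Qed.

End PositiveSubmeasure.

Lemma sm_norm_eq (R : realType) (X Y : metricType R) (mu : (X -> R) -> R)
    (nu : (Y -> R) -> R) : compact [set: X] -> compact [set: Y] ->
  SMplus mu -> SMplus nu ->
  nu (fun=> 1) = mu (fun=> 1) -> nu (fun=> -1) = mu (fun=> -1) ->
  sm_norm nu = sm_norm mu.
Proof.
move=> cX cY muP nuP e1 eN1; rewrite /sm_norm; congr inf.
apply/seteqP; split=> C [C0 HC]; split=> //.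
  by apply/(SMplus_bound_iff cX muP C0); rewrite -e1 -eN1; exact/(SMplus_bound_iff cY nuP C0).
by apply/(SMplus_bound_iff cY nuP C0); rewrite e1 eN1; exact/(SMplus_bound_iff cX muP C0).
Qed.

(* For [h := phi \o f] this is the pushforward, without the upper
   semicontinuous extension: by density and continuity, domination on [D]
   already forces domination of the extension. *)
Definition upper_extension (R : realType) (X : topologicalType) (D : set X)
    (mu : (X -> R) -> R) (h : X -> R) : R :=
  inf [set mu psi | psi in [set psi : X -> R | continuous psi /\
                              forall x, D x -> h x <= psi x]].

Lemma smpushE (R : realType) (X Y : topologicalType) (D : set X) (f : X -> Y)
    (mu : (X -> R) -> R) (phi : Y -> R) :
  compact [set: Y] -> dense D -> continuous phi ->
  smpush D f mu phi = upper_extension D mu (phi \o f).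
Proof.
move=> cY dD cphi; rewrite /smpush /upper_extension; congr inf.
have [M [M0 phiM]] := continuous_compact_bounded cY cphi.
have bf : bounded_on D (phi \o f) by exists M; split=> // x _; exact: phiM.
by apply/seteqP; split=> _ [psi [cpsi H] <-]; exists psi => //; split=> //;
  exact/(Eext_le dD bf cpsi).
Qed.

(** * Extension of a submeasure to functions bounded on a dense set *)

Section UpperExtension.
Context {R : realType} {X : metricType R}.
Variable D : set X.
Hypothesis cX : compact [set: X].
Hypothesis dD : dense D.

(** A constant bound of [h] is a majorant, so the infimum is over a nonempty set. Any [mu] is
    allowed, in particular a sum of two submeasures. *)
Lemma upper_extension_ge (mu : (X -> R) -> R) h c : bounded_on D h ->
  (forall psi : X -> R, continuous psi -> (forall x, D x -> h x <= psi x) ->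
    c <= mu psi) -> c <= upper_extension D mu h.
Proof.
move=> [M [_ hM]] H; apply: lb_le_inf; last by move=> _ [psi [? ?] <-]; exact: H.
exists (mu (fun=> M)), (fun=> M) => //; split; first exact: cst_continuous.
by move=> x Dx; apply: le_trans (hM x Dx); exact: ler_norm.
Qed.

Variable mu : (X -> R) -> R.
Hypothesis muP : SMplus mu.

(** By density every continuous majorant exceeds [- M] everywhere, so monotonicity bounds the family
    of values from below. *)
Lemma upper_extension_le (h psi : X -> R) : bounded_on D h -> continuous psi ->
  (forall x, D x -> h x <= psi x) -> upper_extension D mu h <= mu psi.
Proof.
move=> [M [_ hM]] cpsi hpsi; apply: ge_inf; last by exists psi.
exists (mu (fun=> - M)) => _ [q [cq hq] <-]; apply: SMplus_le => //.
  exact: cst_continuous.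
apply: (dense_continuous_le dD) => // [|x Dx]; first exact: cst_continuous.
by apply: le_trans (hq x Dx); have := hM x Dx; rewrite ler_norml => /andP[].
Qed.

Lemma continuous_bounded_on (p : X -> R) : continuous p -> bounded_on D p.
Proof.
by move=> cp; have [M [M0 pM]] := continuous_compact_bounded cX cp; exists M.
Qed.

Lemma upper_extension_continuous (p : X -> R) : continuous p ->
  upper_extension D mu p = mu p.
Proof.
move=> cp; have bp := continuous_bounded_on cp.
apply/eqP; rewrite eq_le upper_extension_le//=.
apply: upper_extension_ge => // psi cpsi ppsi; apply: SMplus_le => //.
exact: dense_continuous_le ppsi.
Qed.

Lemma bounded_onD (u v : X -> R) : bounded_on D u -> bounded_on D v ->
  bounded_on D (fun x => u x + v x).
Proof.
move=> [M [M0 uM]] [N [N0 vN]]; exists (M + N); split; first exact: addr_ge0.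
by move=> x Dx; rewrite (le_trans (ler_normD _ _))// lerD ?uM ?vN.
Qed.

Lemma bounded_onZ l (u : X -> R) : bounded_on D u ->
  bounded_on D (fun x => l * u x).
Proof.
move=> [M [M0 uM]]; exists (`|l| * M); split; first by rewrite mulr_ge0.
by move=> x Dx; rewrite normrM ler_wpM2l ?uM.
Qed.

Lemma upper_extensionD (u v : X -> R) : bounded_on D u -> bounded_on D v ->
  upper_extension D mu (fun x => u x + v x) <=
  upper_extension D mu u + upper_extension D mu v.
Proof.
move=> bu bv; rewrite -lerBlDr; apply: upper_extension_ge => // p cp up.
rewrite lerBlDr -lerBlDl; apply: upper_extension_ge => // q cq vq.
rewrite lerBlDl; apply: le_trans (SMplusD muP cp cq).
apply: upper_extension_le; [exact: bounded_onD|exact: continuousD_fun|].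
by move=> x Dx; rewrite lerD ?up ?vq.
Qed.

Lemma upper_extension_le_mono (u v : X -> R) : bounded_on D u -> bounded_on D v ->
  (forall x, D x -> u x <= v x) -> upper_extension D mu u <= upper_extension D mu v.
Proof.
move=> bu bv uv; apply: upper_extension_ge => // p cp vp.
by apply: upper_extension_le => // x Dx; exact: le_trans (uv x Dx) (vp x Dx).
Qed.

Lemma upper_extensionZ l (u : X -> R) : bounded_on D u -> 0 <= l ->
  upper_extension D mu (fun x => l * u x) = l * upper_extension D mu u.
Proof.
move=> bu l0; have blu := bounded_onZ l bu.
have [->|l_neq0] := eqVneq l 0.
  rewrite mul0r; under [X in upper_extension D mu X]eq_fun do rewrite mul0r.
  by rewrite upper_extension_continuous ?SMplus0//; exact: cst_continuous.
have l_gt0 : 0 < l by rewrite lt_neqAle eq_sym l_neq0.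
apply/eqP; rewrite eq_le; apply/andP; split.
  rewrite -ler_pdivrMl//; apply: upper_extension_ge => // p cp up.
  rewrite ler_pdivrMl// -(SMplusZ muP cp l0).
  apply: upper_extension_le => //; first exact: continuousZ_fun.
  by move=> x Dx; rewrite ler_wpM2l// up.
apply: upper_extension_ge => // p cp up.
rewrite -ler_pdivlMl// -(SMplusZ muP cp) ?invr_ge0//.
apply: upper_extension_le => //; first exact: continuousZ_fun.
by move=> x Dx; rewrite ler_pdivlMl// up.
Qed.

End UpperExtension.

(** * Pushforward *)

Section Pushforward.
Context {R : realType} {X Y : metricType R}.
Hypothesis cX : compact [set: X].
Hypothesis cY : compact [set: Y].
Variables (D : set X) (f : X -> Y).
Hypothesis dD : dense D.

Let bphi (phi : Y -> R) : continuous phi -> bounded_on D (phi \o f).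
Proof.
move=> /(continuous_compact_bounded cY)[M [M0 phiM]].
by exists M; split=> // x _; exact: phiM.
Qed.

Lemma smpush_cst (mu : (X -> R) -> R) (c : R) : SMplus mu ->
  smpush D f mu (fun=> c) = mu (fun=> c).
Proof.
move=> muP; rewrite smpushE//; last exact: cst_continuous.
by rewrite (_ : _ \o f = fun=> c)// upper_extension_continuous//; exact: cst_continuous.
Qed.

Lemma smpush_SMplus (mu : (X -> R) -> R) : SMplus mu -> SMplus (smpush D f mu).
Proof.
move=> muP.
have push_le (p q : Y -> R) : continuous p -> continuous q -> (forall y, p y <= q y) ->
    smpush D f mu p <= smpush D f mu q.
  move=> cp cq pq; rewrite !smpushE//; apply: upper_extension_le_mono => //.
  - exact: bphi.
  - exact: bphi.
  - by move=> x _; exact: pq.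
have pushZ (l : R) (p : Y -> R) : continuous p -> 0 <= l ->
    smpush D f mu (fun y => l * p y) = l * smpush D f mu p.
  move=> cp l0; rewrite !smpushE//; last exact: continuousZ_fun.
  by rewrite -upper_extensionZ//; exact: bphi.
split=> //; split=> // [p q cp cq|].
  rewrite !smpushE//; last exact: continuousD_fun.
  by apply: upper_extensionD => //; exact: bphi.
pose C := Num.max `|mu (fun=> 1)| `|mu (fun=> -1)|.
exists C; apply: homogeneous_monotone_bound => //.
- by rewrite smpush_cst// le_max lexx.
- by rewrite smpush_cst// le_max lexx orbT.
Qed.

(** For a fixed continuous majorant [psi] of [phi \o f], the pushforward of [mun (sigma n)] at [phi]
    is at most [mun (sigma n) psi]. The limit in [n] is taken first, the infimum over [psi]
    afterwards. *)
Lemma smpush_cvg_le (mun : nat -> (X -> R) -> R) (mu : (X -> R) -> R)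
    (nu : (Y -> R) -> R) : (forall n, SMplus (mun n)) -> SMplus mu ->
  weak_cvg mun mu -> weak_cluster (fun n => smpush D f (mun n)) nu ->
  sm_le nu (smpush D f mu).
Proof.
move=> munP muP [_ mun_cvg] [sigma [sigma_lt [_ nu_cvg]]] phi cphi.
rewrite smpushE//; apply: upper_extension_ge => [|psi cpsi phipsi]; first exact: bphi.
have sigma_ge n : (n <= sigma n)%N.
  by elim: n => // n IH; exact: leq_ltn_trans IH (sigma_lt n).
have sigma_cvg : sigma @ \oo --> \oo.
  by move=> A [N _ NA]; exists N => // n Nn; apply: NA; exact: leq_trans Nn (sigma_ge n).
have mus_cvg : (fun n => mun (sigma n) psi) @ \oo --> mu psi.
  exact: cvg_comp sigma_cvg (mun_cvg psi cpsi).
apply: (ler_cvg_to (nu_cvg phi cphi) mus_cvg).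
near=> n; rewrite smpushE//; apply: upper_extension_le => //; exact: bphi.
Unshelve. all: by end_near. Qed.

(** The integrals of the decreasing majorants give one inequality, monotonicity of the integral over
    [D] the other; the null set off [D] does not affect integrals. *)
Lemma smpush_measure (x0 : X) (mu : {finite_measure set @BorelSpace X x0 -> \bar R})
    (phi : Y -> R) : open D -> (forall x, D x -> {for x, continuous f}) ->
  mu (~` D) = 0%E -> continuous phi ->
  ((smpush D f (meas_sm mu) phi)%:E = \int[mu]_(x in D) (phi (f x))%:E)%E.
Proof.
move=> oD cf muD cphi.
have mD : measurable (D : set (@BorelSpace X x0)) by exact: open_borel_measurable.
have intD (psi : X -> R) : continuous psi ->
    ((meas_sm mu psi)%:E = \int[mu]_(x in D) (psi x)%:E)%E.
  move=> cpsi; rewrite meas_smE//.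
  rewrite (@negligible_integral _ (@BorelSpace X x0) R mu setT (~` D))//.
  - by rewrite setTD setCK.
  - exact: measurableC.
  - exact: continuous_integrable.
have [M [M0 hM]] := bphi cphi.
have ch x : D x -> {for x, continuous (phi \o f)}.
  by move=> Dx; apply: continuous_comp; [exact: cf|exact: cphi].
have [psi [cpsi hpsi ih psi_cvg]] := cvg_majorants mu cX oD ch M0 hM.
have muP := meas_sm_SMplus mu cX.
rewrite smpushE//; apply/eqP; rewrite eq_le; apply/andP; split.
  apply: (cvge_to_ge psi_cvg); apply: nearW => n /=.
  by rewrite -intD// lee_fin; apply: upper_extension_le => //; [exact: bphi|exact: hpsi].
rewrite -[leLHS]fineK; last exact: integrable_fin_num.
rewrite lee_fin; apply: upper_extension_ge => [|q cq hq]; first exact: bphi.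
rewrite -lee_fin fineK; last exact: integrable_fin_num.
rewrite intD//; apply: le_integral => //.
  by apply: integrableS (continuous_integrable mu cX cq).
by move=> x /set_mem Dx; rewrite lee_fin; exact: hq.
Qed.

(** The supremum is attained, at the measure representing a linear functional that touches
    [upper_extension D mu] at [phi \o f]. *)
Lemma smpush_sup_measures (x0 : X) (mu : (X -> R) -> R) (phi : Y -> R) :
  SMplus mu -> continuous phi ->
  smpush D f mu phi
    = sup [set smpush D f (meas_sm chi) phi |
             chi in [set chi : {finite_measure set @BorelSpace X x0 -> \bar R}
                       | sm_le (meas_sm chi) mu]].
Proof.
move=> muP cphi; have bf := bphi cphi.
have push_le (chi : {finite_measure set @BorelSpace X x0 -> \bar R}) :
    sm_le (meas_sm chi) mu -> smpush D f (meas_sm chi) phi <= smpush D f mu phi.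
  move=> chimu; rewrite !smpushE//; apply: upper_extension_ge => // psi cpsi hpsi.
  apply: le_trans (chimu psi cpsi); apply: upper_extension_le => //.
  exact: meas_sm_SMplus.
have [L [LD LZ Lle Lphi]] := @hahn_banach R (X -> R^o) (@bounded_on R X D)
  (@bounded_onD _ _ D) (@bounded_onZ _ _ D) (upper_extension D mu) (phi \o f)
  (conj (upper_extensionD dD muP) (fun l u l0 bu => upper_extensionZ cX dD muP bu l0)) bf.
have Lmu (p : X -> R) : continuous p -> L p <= mu p.
  move=> cp; rewrite -(upper_extension_continuous cX dD muP cp).
  by apply: Lle; exact: continuous_bounded_on.
have LN (u : X -> R) : bounded_on D u -> L (fun x => -1 * u x) = - L u.
  by move=> bu; rewrite -[RHS]mulN1r; exact: (LZ (-1) u bu).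
(* Where [u <= v] on [D], the constant 0 is a continuous majorant of [u - v], so [L (u - v)] is at
   most [mu 0 = 0]. *)
have L_ge (u v : X -> R) : bounded_on D u -> bounded_on D v ->
    (forall x, D x -> u x <= v x) -> L u <= L v.
  move=> bu bv uv; have bNv := bounded_onZ (-1) bv.
  rewrite -subr_le0 -LN//.
  have <- : L (fun x => u x + -1 * v x) = L u + L (fun x => -1 * v x) by exact: LD.
  apply: le_trans (Lle _ (bounded_onD bu bNv)) _.
  rewrite -(SMplus0 muP); apply: upper_extension_le => //.
  - exact: bounded_onD.
  - exact: cst_continuous.
  - by move=> x Dx; rewrite mulN1r subr_le0 uv.
have posL : positive_linear L.
  split=> [p q cp cq|l p cp|p cp p0].
  - by apply: LD; exact: continuous_bounded_on.
  - by apply: LZ; exact: continuous_bounded_on.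
  - have L0 : L (fun=> 0) = 0.
      by have := LZ 0 _ bf; rewrite scale0r mul0r.
    rewrite -L0; apply: L_ge => //; apply: continuous_bounded_on => //.
    exact: cst_continuous.
have [chi chiL] := riesz_representation x0 cX posL.
have chimu : sm_le (meas_sm chi) mu by move=> p cp; rewrite chiL// Lmu.
apply/eqP; rewrite eq_le; apply/andP; split; last first.
  apply: ge_sup; last by move=> _ [xi ximu <-]; exact: push_le.
  by exists (smpush D f (meas_sm chi) phi), chi.
apply: (@le_trans _ _ (smpush D f (meas_sm chi) phi)); last first.
  apply: ub_le_sup; last by exists chi.
  by exists (smpush D f mu phi) => _ [xi ximu <-]; exact: push_le.
(* For a majorant [psi], the integral is [L psi], at least [L (phi \o f)], which is the pushforward
   of [mu] at [phi]. *)
rewrite !smpushE//; apply: upper_extension_ge => // psi cpsi hpsi.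
rewrite chiL// -Lphi; apply: L_ge => //; exact: continuous_bounded_on.
Qed.

(** The left side may use different majorants for [mu1] and [mu2], the right side a common one. *)
Lemma smpush_superadditive (mu1 mu2 : (X -> R) -> R) (phi : Y -> R) :
  SMplus mu1 -> SMplus mu2 -> continuous phi ->
  smpush D f mu1 phi + smpush D f mu2 phi
    <= smpush D f (fun p => mu1 p + mu2 p) phi.
Proof.
move=> mu1P mu2P cphi; rewrite !smpushE//.
apply: upper_extension_ge => [|psi cpsi hpsi]; first exact: bphi.
by apply: lerD; apply: upper_extension_le => //; exact: bphi.
Qed.

Lemma smpush_continuous (mu : (X -> R) -> R) (phi : Y -> R) :
  continuous f -> SMplus mu -> continuous phi ->
  smpush D f mu phi = mu (phi \o f).
Proof.
move=> cf muP cphi; rewrite smpushE// upper_extension_continuous//.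
by move=> x; apply: continuous_comp; [exact: cf|exact: cphi].
Qed.

(** If [psi] majorizes [phi \o g] on [Dg] and [q] majorizes [psi \o f] on [D], then [q] majorizes
    [phi \o g \o f] on [U]. *)
Lemma smpush_comp_le (Z : metricType R) (Dg : set Y) (g : Y -> Z) (U : set X)
    (mu : (X -> R) -> R) (phi : Z -> R) : compact [set: Z] -> dense Dg ->
  dense U -> U `<=` D -> f @` U `<=` Dg -> SMplus mu -> continuous phi ->
  smpush U (g \o f) mu phi <= smpush Dg g (smpush D f mu) phi.
Proof.
move=> cZ dDg dU UD fU muP cphi.
have [M [M0 phiM]] := continuous_compact_bounded cZ cphi.
rewrite [leRHS]smpushE//; apply: upper_extension_ge => [|psi cpsi hpsi].
  by exists M; split=> // x _; exact: phiM.
rewrite !smpushE//; apply: upper_extension_ge => [|q cq hq]; first exact: bphi.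
apply: upper_extension_le => //; first by exists M; split=> // x _; exact: phiM.
move=> x Ux; apply: le_trans (hq x (UD x Ux)).
by apply: hpsi; apply: fU; exists x.
Qed.

End Pushforward.

Theorem theorem2p10 (R : realType) (X Y : metricType R)
  (cX : compact [set: X]) (cY : compact [set: Y])
  (D : set X) (f : X -> Y) (hf : odmap D f) :
  (* 1) *)
  (forall mu : (X -> R) -> R, SMplus mu ->
     [/\ SMplus (smpush D f mu),
         smpush D f mu (fun _ => 1) = mu (fun _ => 1),
         smpush D f mu (fun _ => -1) = mu (fun _ => -1) &
         sm_norm (smpush D f mu) = sm_norm mu]) /\
  (* 2) *)
  (forall (Z : metricType R) (cZ : compact [set: Z]) (Dg : set Y) (g : Y -> Z)
          (U : set X),
     odmap Dg g -> open U -> dense U -> U `<=` D -> f @` U `<=` Dg ->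
     (forall mu : (X -> R) -> R, SMplus mu ->
        forall phi : Z -> R, continuous phi ->
          smpush U (g \o f) mu phi
            <= smpush Dg g (smpush D f mu) phi) /\
     (D = setT -> Dg = setT ->
      forall mu : (X -> R) -> R, SMplus mu ->
        forall phi : Z -> R, continuous phi ->
          smpush Dg g (smpush D f mu) phi
            = smpush U (g \o f) mu phi)) /\
  (* 3) *)
  (forall (mun : nat -> (X -> R) -> R) (mu : (X -> R) -> R),
     (forall n, SMplus (mun n)) -> SMplus mu -> weak_cvg mun mu ->
     (forall nu : (Y -> R) -> R,
        weak_cluster (fun n => smpush D f (mun n)) nu ->
        sm_le nu (smpush D f mu)) /\
     (D = setT ->
        weak_cvg (fun n => smpush D f (mun n)) (smpush D f mu))) /\
  (* 4) *)
  (forall (x0 : X) (mu : {finite_measure set @BorelSpace X x0 -> \bar R}),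
     mu (~` D) = 0%E ->
     forall phi : Y -> R, continuous phi ->
       ((smpush D f (meas_sm mu) phi)%:E
          = \int[mu]_(x in D) (phi (f x))%:E)%E) /\
  (* 5) *)
  (forall (x0 : X) (mu : (X -> R) -> R), SMplus mu ->
     forall phi : Y -> R, continuous phi ->
       smpush D f mu phi
         = sup [set smpush D f (meas_sm chi) phi |
                  chi in [set chi : {finite_measure set @BorelSpace X x0 -> \bar R}
                            | sm_le (meas_sm chi) mu]]) /\
  (* 6) *)
  (forall mu1 mu2 : (X -> R) -> R, SMplus mu1 -> SMplus mu2 ->
     forall phi : Y -> R, continuous phi ->
       smpush D f mu1 phi + smpush D f mu2 phi
         <= smpush D f (fun p => mu1 p + mu2 p) phi).
Proof.
have [oD dD cf] := hf.
have pushP (mu : (X -> R) -> R) : SMplus mu -> SMplus (smpush D f mu) by exact: smpush_SMplus.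
have cf' : D = setT -> continuous f by move=> DT x; apply: cf; rewrite DT.
have push_norm (mu : (X -> R) -> R) : SMplus mu -> sm_norm (smpush D f mu) = sm_norm mu.
  by move=> muP; apply: sm_norm_eq => //; [exact: pushP|exact: smpush_cst|exact: smpush_cst].
split; [|split; [|split; [|split; [|split]]]].
- by move=> mu muP; split; [exact: pushP|exact: smpush_cst|exact: smpush_cst|exact: push_norm].
- move=> Z cZ Dg g U [oDg dDg cg] oU dU UD fU; split=> [mu muP phi cphi|DT DgT mu muP phi cphi].
    exact: smpush_comp_le.
  have cgT : continuous g by move=> y; apply: cg; rewrite DgT.
  have cphig : continuous (phi \o g).
    by move=> y; apply: continuous_comp; [exact: cgT|exact: cphi].
  (* For continuous maps every pushforward is evaluation at the composite, so both sides become [mu]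
     at [phi \o g \o f]. *)
  rewrite (smpush_continuous cY cZ dDg)//; last exact: pushP.
  rewrite (smpush_continuous cX cY dD)//; last exact: cf'.
  rewrite (smpush_continuous cX cZ dU)//.
  by move=> x; apply: continuous_comp; [exact: cf'|exact: cgT].
- move=> mun mu munP muP mun_cvg; split=> [nu|DT]; first exact: smpush_cvg_le.
  case: mun_cvg => [[M munM] mun_cvg]; split.
    by exists M => n; rewrite push_norm.
  move=> phi cphi; rewrite (smpush_continuous cX cY dD (cf' DT))//.
  rewrite (_ : (fun n => _) = fun n => mun n (phi \o f)).
    by apply: mun_cvg => x; apply: continuous_comp; [exact: cf'|exact: cphi].
  by apply/funext => n; rewrite (smpush_continuous cX cY dD (cf' DT)).
- by move=> x0 mu muD phi cphi; exact: smpush_measure.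
- by move=> x0 mu muP phi cphi; exact: smpush_sup_measures.
- by move=> mu1 mu2 mu1P mu2P phi cphi; exact: smpush_superadditive.
Qed.
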